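(* Let $r\ge 2$ be a fixed positive integer. There exist constants $c>0$ and $N_0$, depending only on $r$, such that the following holds. Let $\Gamma$ be a finite abelian group with $2\nmid|\Gamma|$ and $|\Gamma|\ge N_0$, and let $A\subseteq\Gamma$. If the Cayley sum graph $\mathrm{Cay}(\Gamma,A)$ does not contain any copy of the complete graph $K_r$ on $r$ vertices, then its edge density is at most $2^{-c\,(\log|\Gamma|)^{1/16}}$.
   Context: $\log$ is base 2. The Cayley sum graph $\mathrm{Cay}(\Gamma,A)$ is the graph with vertex set $\Gamma$ and edge set $\{\{x,y\}: x+y\in A\}$. A copy of $K_r$ is a set of $r$ distinct vertices $x_1,\dots,x_r\in\Gamma$ with $x_i+x_j\in A$ for all $i\ne j$. The edge density is the probability that $\mathbf x+\mathbf y\in A$ for independent uniform $\mathbf x,\mathbf y\in\Gamma$. *)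

(* Defs.v *)
From mathcomp Require Import all_boot all_order all_algebra.
From mathcomp Require Import reals exp.

Set Implicit Arguments.
Unset Strict Implicit.
Unset Printing Implicit Defensive.

Import Order.TTheory GRing.Theory Num.Theory.

Local Open Scope ring_scope.

(* Adjacency is not made irreflexive: {x, x} is an edge when x + x is in A.
   These loops count in the density but play no role in copies of K_r. *)
Definition cayley_sum_graph (G : finZmodType) (A : {set G}) : rel G :=
  fun x y => x + y \in A.

Definition copy_of_K (T : finType) (e : rel T) (r : nat) (S : {set T}) : Prop :=
  #|S| = r /\ {in S &, forall x y, x != y -> e x y}.

(* Probability that e x y holds for independent uniform x and y; the pairs are
   ordered and x = y is allowed. *)
Definition edge_density (R : realType) (T : finType) (e : rel T) : R :=
  #|[set p : T * T | e p.1 p.2]|%:R / (#|T| ^ 2)%N%:R.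

Definition log2 (R : realType) (x : R) : R := ln x / ln 2.

(* Main.v *)
(** Fix [r] and write [N] for the order of the group. A set [A] of density
    above [C N^(-1/2^r)] contains an [r]-dimensional Hilbert cube: replace [A]
    repeatedly by [A :&: (A - h)], where [h] avoids the steps already used and
    makes the intersection as large as its average, so that each step
    essentially squares the density. If [y + sum_{i in I} h_i] lies in [A] for
    all [I], then [x_i = y / 2 + h_i] are distinct and
    [x_i + x_j = y + h_i + h_j] lies in [A]. Hence a [K_r]-free Cayley sum
    graph has density at most [C N^(-1/2^r)], which is much smaller than the
    claimed bound. *)
Require Import Defs.
From mathcomp Require Import all_boot all_order all_algebra.
From mathcomp Require Import fingroup cyclic.
From mathcomp Require Import reals exp.
From mathcomp Require Import zify ring lra.

Import Order.TTheory GRing.Theory Num.Theory.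

Local Open Scope ring_scope.

Lemma odd_card_halve (G : finZmodType) (y : G) :
  ~~ (2 %| #|G|)%N -> exists z : G, z + z = y.
(* As [#|G|] is odd, [(#|G| + 1) / 2] is an inverse of 2 modulo [#|G|]. *)
Proof.
move=> Godd; exists (y *+ (#|G|.+1)./2).
have yG : y *+ #|G| = 0.
  by have /(_ (in_setT y)) := @expg_cardG G [set: G]%G y; rewrite cardsT FinRing.zmodXgE.
rewrite -mulrnDr addnn halfK /= -dvdn2 (negbTE Godd) /= subn0 mulrSr.
by rewrite yG add0r.
Qed.

Lemma card_addr_preim (G : finZmodType) (A : {set G}) (x : G) :
  #|[set y | x + y \in A]| = #|A|.
Proof.
rewrite -(card_imset (mem A) (addrI (- x))); apply: eq_card => y; rewrite !inE.
apply/idP/imsetP => [xyA|[z zA ->]]; first by exists (x + y); rewrite ?addKr.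
by rewrite addrA subrr add0r.
Qed.

Lemma sum_card_shift (G : finZmodType) (A : {set G}) :
  (\sum_(h : G) #|[set a in A | (a + h)%R \in A]| = #|A| * #|A|)%N.
Proof.
under eq_bigr => h _ do rewrite -sum1dep_card big_mkcondr /=.
rewrite exchange_big /= -sum_nat_const; apply: eq_bigr => a _.
by rewrite -big_mkcond /= sum1dep_card card_addr_preim.
Qed.

(** The intersections of [A] with its shifts have total size [#|A| ^ 2], and each has size at most
    [#|A|]. So the shifts in [T] account for at most half of the total, and some shift outside [T]
    reaches the average of the rest over at most [#|G|] shifts. *)
Lemma popular_shift (G : finZmodType) (A T : {set G}) :
  (0 < #|A|)%N -> (2 * #|T| <= #|A|)%N ->
  exists2 h, h \notin T &
    (#|A| ^ 2 <= 2 * #|G| * #|[set a in A | (a + h)%R \in A]|)%N.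
Proof.
move=> A0 TA; set f := fun h : G => #|[set a in A | a + h \in A]|.
case: (pickP [pred h | h \notin T & (#|A| ^ 2 <= 2 * #|G| * f h)%N]) => [h|none].
  by case/andP=> hT hA; exists h.
have sumT : (\sum_(h in T) f h <= #|T| * #|A|)%N.
  rewrite -sum_nat_const; apply: leq_sum => h _.
  by apply/subset_leq_card/subsetP => a; rewrite inE => /andP[].
have sumE : (\sum_(h in T) f h + \sum_(h in ~: T) f h = #|A| ^ 2)%N.
  rewrite -mulnn -sum_card_shift [RHS](bigID (mem T)) /=.
  by congr addn; apply: eq_bigl => h; rewrite inE.
(* The predecessor records that every shift outside [T] fails strictly; this gives the final
   contradiction. *)
have sumC : (\sum_(h in ~: T) 2 * #|G| * f h <= #|~: T| * (#|A| ^ 2).-1)%N.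
  rewrite -sum_nat_const; apply: leq_sum => h; rewrite inE => hT.
  by move: (none h); rewrite /= hT /=; lia.
rewrite -big_distrr /= in sumC.
have A2 : (0 < #|A| ^ 2)%N by rewrite expn_gt0 A0.
have G0 : (0 < #|G|)%N by apply: leq_trans A0 (max_card _).
have le1 : (2 * \sum_(h in T) f h <= #|A| ^ 2)%N.
  apply: leq_trans (_ : 2 * (#|T| * #|A|) <= _)%N; first by rewrite leq_mul2l.
  by rewrite mulnA -mulnn leq_mul2r TA orbT.
have le2 : (#|A| ^ 2 <= 2 * \sum_(h in ~: T) f h)%N.
  by move: sumE le1; move: (\sum_(h in T) f h)%N (\sum_(h in ~: T) f h)%N (_ ^ 2)%N; lia.
have leC : (#|~: T| <= #|G|)%N := max_card _.
have : (#|G| * #|A| ^ 2 <= #|G| * (#|A| ^ 2).-1)%N.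
  apply: leq_trans (leq_trans sumC (leq_mul leC (leqnn _))).
  by rewrite mulnAC mulnC leq_mul2r le2 orbT.
by rewrite leq_pmul2l // leqNgt prednK // leqnn.
Qed.

(* Keeps only the part of a Hilbert cube with base point [y] and side set [S]
   on sums of at most two sides. *)
Lemma truncated_cube (G : finZmodType) (K m : nat) (A T : {set G}) :
  (0 < K)%N -> (#|T| + m <= K)%N ->
  (K * (2 * #|G|) ^ (2 ^ m) <= #|G| * #|A| ^ (2 ^ m))%N ->
  exists (S : {set G}) (y : G),
    [/\ #|S| = m, {in S, forall h, h \notin T}, y \in A,
        {in S, forall h, y + h \in A}
      & {in S &, forall h k, h != k -> y + (h + k) \in A}].
Proof.
move=> K0; have G0 : (0 < #|G|)%N by apply/card_gt0P; exists 0.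
elim: m A T => [|m IH] A T TK.
  rewrite !expn1 => KA; have /card_gt0P [y yA] : (0 < #|A|)%N by nia.
  exists set0, y; split=> // [|h|h|h k]; rewrite ?cards0 ?inE //.
move=> KA; have AG : (#|A| <= #|G|)%N := max_card _.
(* All but one of the factors [#|A|] are bounded by [2 * #|G|] and cancelled. This makes [A] large
   enough to avoid [T], since [#|T| < K]. *)
have A2K : (2 * K <= #|A|)%N.
  have M0 : (0 < 2 ^ m.+1)%N by rewrite expn_gt0.
  move: KA; rewrite -(prednK M0) !expnS; set M := _.-1 => KA.
  have AM : (#|A| ^ M <= (2 * #|G|) ^ M)%N.
    by case: (M) => [|p] //; rewrite leq_exp2r //; lia.
  have GM : (0 < #|G| * (2 * #|G|) ^ M)%N by rewrite muln_gt0 expn_gt0 muln_gt0 G0.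
  rewrite -(leq_pmul2r GM); move: KA; set P := ((2 * _) ^ M)%N in AM *; nia.
have A0 : (0 < #|A|)%N by lia.
have [|h hT] := @popular_shift G A T A0; first by lia.
set B := [set a in A | _] => AB.
(* Adding [h] to the forbidden set keeps the later sides different from [h]; [#|T| + m] is
   unchanged, so the same [K] serves throughout. *)
have [||S [y [cS dS yB ySB ySSB]]] := IH B (h |: T).
- by rewrite cardsU1 hT; lia.
(* Measured by [#|A| / (2 * #|G|)], passing to [B] at worst squares the density: the extra 2 absorbs
   the loss in [popular_shift]. *)
- have P0 : (0 < (2 * #|G|) ^ (2 ^ m))%N by rewrite expn_gt0 muln_gt0 G0.
  rewrite -(leq_pmul2r P0) -mulnA -expnD addnn -mul2n -expnS.
  apply: leq_trans KA _; rewrite expnS expnM -mulnA leq_pmul2l // mulnC -expnMn.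
  by rewrite leq_exp2r ?expn_gt0.
have hS : h \notin S by apply/negP => /dS; rewrite setU11.
have BA a : a \in B -> a \in A by rewrite inE => /andP[].
have BhA a : a \in B -> a + h \in A by rewrite inE => /andP[].
exists (h |: S), y; split.
- by rewrite cardsU1 hS cS.
- by move=> k /setU1P[->//|/dS]; rewrite !inE negb_or => /andP[].
- exact: BA.
- by move=> k /setU1P[->|kS]; [apply: BhA | apply/BA/ySB].
- move=> k l /setU1P[->|kS] /setU1P[->|lS] => [|_|_|kl]; first by rewrite eqxx.
  + by rewrite [h + l]addrC addrA; apply/BhA/ySB.
  + by rewrite addrA; apply/BhA/ySB.
  + by apply/BA/ySSB.
Qed.

Lemma clique_free_card (G : finZmodType) (A : {set G}) (r : nat) :
  (0 < r)%N -> ~~ (2 %| #|G|)%N ->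
  ~ (exists S : {set G}, copy_of_K (cayley_sum_graph A) r S) ->
  (#|G| * #|A| ^ (2 ^ r) < r * (2 * #|G|) ^ (2 ^ r))%N.
Proof.
move=> r0 Godd free; rewrite ltnNge; apply/negP => dense; apply: free.
have [||S [y [cS _ _ _ yS]]] := @truncated_cube G r r A set0 r0.
- by rewrite cards0.
- exact: dense.
have [z zy] := odd_card_halve G y Godd.
exists [set z + h | h in S]; split; first by rewrite card_imset //; apply: addrI.
move=> _ _ /imsetP[h hS ->] /imsetP[k kS ->]; rewrite (inj_eq (addrI z)) => hk.
by rewrite /cayley_sum_graph addrACA zy yS.
Qed.

Lemma edge_density_cayley (R : realType) (G : finZmodType) (A : {set G}) :
  edge_density R (cayley_sum_graph A) = #|A|%:R / #|G|%:R.
Proof.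
have G0 : (#|G|%:R : R) != 0.
  by rewrite pnatr_eq0 -lt0n; apply/card_gt0P; exists 0.
have -> : edge_density R (cayley_sum_graph A)
  = (#|G| * #|A|)%:R / (#|G| ^ 2)%:R.
  congr (_%:R / _).
  rewrite -sum1dep_card -(pair_big_dep xpredT (fun x y => x + y \in A)
     (fun _ _ => 1%N)) /= -sum_nat_const; apply: eq_bigr => x _.
  by rewrite sum1dep_card card_addr_preim.
by rewrite natrM natrX; field.
Qed.

Theorem corollary1p6 (R : realType) (r : nat) (hr : (2 <= r)%N) :
  exists (c : R) (N0 : nat), 0 < c /\
    forall (G : finZmodType) (A : {set G}),
      ~~ (2 %| #|G|)%N -> (N0 <= #|G|)%N ->
      ~ (exists S : {set G}, copy_of_K (cayley_sum_graph A) r S) ->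
      edge_density R (cayley_sum_graph A)
        <= 2 `^ (- c * (log2 (#|G|%:R : R)) `^ (16^-1)).
Proof.
set M := (2 ^ r)%N; set C := (r * 2 ^ M)%N.
have M0 : (0 < M)%N by rewrite expn_gt0.
have MR : 0 < M%:R :> R by rewrite ltr0n.
have C2 : (2 <= C)%N by rewrite (leq_trans hr) // leq_pmulr // expn_gt0.
have ln2 : 0 < ln 2 :> R by rewrite ln_gt0 // ltr1n.
(* The density [d] will satisfy [d ^+ M * N <= C]. Once [N >= C ^ 2], the constant [C] costs at most
   a factor [N^(1/2)], so [d <= N^(-1/(2M))]. *)
exists (2 * M%:R)^-1, (C ^ 2)%N; split; first by rewrite invr_gt0 mulr_gt0.
move=> G A Godd GN free; rewrite edge_density_cayley.
have := @clique_free_card G A r (ltnW hr) Godd free; rewrite -/M.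
set N := #|G| in GN *; set a := #|A| => aN.
have N2 : (2 <= N)%N by nia.
have N0 : 0 < N%:R :> R by rewrite ltr0n; lia.
set d : R := a%:R / N%:R.
(* The empty set is treated apart because the rest takes the logarithm of [d]. *)
have [a0|a0] := posnP a; first by rewrite /d a0 mul0r powR_ge0.
have d0 : 0 < d by rewrite divr_gt0 // ltr0n.
have dM : d ^+ M * N%:R <= C%:R.
  rewrite /d expr_div_n mulrAC ler_pdivrMr ?exprn_gt0 // -!natrX -!natrM ler_nat.
  by rewrite -mulnA -expnMn mulnC ltnW.
have lnC : ln C%:R *+ 2 <= ln N%:R :> R.
  have C0 : 0 < C%:R :> R by rewrite ltr0n; lia.
  by rewrite -lnXn // ler_ln ?posrE ?exprn_gt0 // -natrX ler_nat.
have lnd : ln d *+ M + ln N%:R <= ln C%:R.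
  rewrite -lnXn // -lnM ?posrE ?exprn_gt0 //.
  by rewrite ler_ln ?posrE ?mulr_gt0 ?exprn_gt0 // ltr0n; lia.
set L := log2 _.
have L1 : 1 <= L by rewrite /L /log2 ler_pdivlMr // mul1r ler_ln ?posrE // ler_nat.
(* Since [L >= 1], it suffices to prove the stronger bound with [L] in place of its 16th root. *)
have L16 : L `^ 16^-1 <= L.
  rewrite -{2}(powRr1 (le_trans ler01 L1)) ler_powR //.
  by rewrite invf_le1 // ler1n.
rewrite -ler_ln ?posrE ?powR_gt0 // ln_powR.
apply: (@le_trans _ _ (- (2 * M%:R)^-1 * L * ln 2)); last first.
  by rewrite ler_pM2r // ler_wnM2l // oppr_le0 invr_ge0 mulr_ge0.
have -> : - (2 * M%:R)^-1 * L * ln 2 = - ln N%:R / 2 / M%:R.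
  by rewrite /L /log2; field; rewrite !gt_eqF.
rewrite ler_pdivlMr // mulr_natr.
lra.
Qed.
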